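(* Let $\varepsilon>0$, and let the process $X$ and the intensity functions $\alpha_i$ for $i=0,1,\dots,K$ be kept fixed when a $(K+1)$-th institution (with intensity function $\alpha_{K+1}$) is added. Then $$\mathbb{P}\left(|\tau_i-\tau_j|<\varepsilon\text{ for some }(i,j)\in\{1,\dots,K\}^2,\ i\ne j\right)<\mathbb{P}\left(|\tau_i-\tau_j|<\varepsilon\text{ for some }(i,j)\in\{1,\dots,K+1\}^2,\ i\ne j\right).$$
   Context: Let $(\Omega,\mathcal F,\mathbb P,\mathbb F)$ be a filtered probability space satisfying the usual conditions, carrying an $\mathbb R^d$-valued process $X=(X_t)_{t\ge 0}$ with right-continuous paths with left limits, and exponential random variables $Z_0,Z_1,\dots,Z_{K+1}$ of parameter $1$, independent of each other and of $X$. For $i=0,1,\dots,K+1$ let $\alpha_i:\mathbb R^d\to[0,\infty)$ be a non-random, positive, continuous function, and put $A_i(s)=\int_0^s\alpha_i(X_r)\,dr$; assume $\lim_{s\to\infty}A_i(s)=\infty$. Thus each $A_i$ is continuous and strictly increasing. Define $\eta_i=\inf\{s: A_i(s)\ge Z_i\}$ for $i=0,\dots,K+1$, and the default times $\tau_i=\min(\eta_0,\eta_i)$ for $i=1,\dots,K+1$. *)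

(* Defs.v *)
From HB Require Import structures.
From mathcomp Require Import all_boot all_order all_algebra.
From mathcomp Require Import all_classical all_reals all_analysis.

Set Implicit Arguments.
Unset Strict Implicit.
Unset Printing Implicit Defensive.

Import Order.TTheory GRing.Theory Num.Theory.
Import numFieldNormedType.Exports.

Local Open Scope classical_set_scope.
Local Open Scope ring_scope.
Local Open Scope ereal_scope.

(* Processes and filtrations are indexed by R; only their values at times
   t >= 0 are ever constrained or used. *)

Definition usual_conditions (d : measure_display) (T : measurableType d)
    (R : realType) (P : probability T R) (F : R -> set (set T)) : Prop :=
  [/\ forall t, (0 <= t)%R -> sigma_algebra setT (F t) /\ F t `<=` measurable,
      forall s t, (0 <= s)%R -> (s <= t)%R -> F s `<=` F t,
      forall t, (0 <= t)%R -> F t = \bigcap_(s in [set s | (t < s)%R]) F s &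
      P.-negligible `<=` F 0%R].

Definition borel_rV (R : realType) (n : nat) : set (set 'rV[R]_n) :=
  <<s (@open 'rV[R]_n) >>.

Definition vector_process (d : measure_display) (T : measurableType d)
    (R : realType) (n : nat) (X : R -> T -> 'rV[R]_n) : Prop :=
  forall t, (0 <= t)%R ->
    preimage_set_system setT (X t) (@borel_rV R n) `<=` measurable.

Definition cadlag (R : realType) (n : nat) (x : R -> 'rV[R]_n) : Prop :=
  (forall t, (0 <= t)%R -> x s @[s --> t^'+] --> x t) /\
  (forall t, (0 < t)%R -> cvg (x s @[s --> t^'-])).

Definition process_sigma (T : Type) (R : realType) (n : nat)
    (X : R -> T -> 'rV[R]_n) : set (set T) :=
  <<s \bigcup_(t in [set t : R | (0 <= t)%R])
        preimage_set_system setT (X t) (@borel_rV R n) >>.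

Definition mutually_independent (d : measure_display) (T : measurableType d)
    (R : realType) (P : probability T R) (I : finType)
    (G : I -> set (set T)) : Prop :=
  forall (J : {set I}) (E : I -> set T), (forall i, i \in J -> G i (E i)) ->
    P (\bigcap_(i in [set i | i \in J]) E i) = \prod_(i in J) P (E i).

(* The sigma-algebra of X has index None, that of Z i has index Some i. *)
Definition generated_sigmas (d : measure_display) (T : measurableType d)
    (R : realType) (n : nat) (I : Type) (X : R -> T -> 'rV[R]_n)
    (Z : I -> T -> R) (o : option I) : set (set T) :=
  if o is Some i then preimage_set_system setT (Z i) measurable
  else process_sigma X.

Definition cumulative_intensity (T : Type) (R : realType) (n : nat)
    (X : R -> T -> 'rV[R]_n) (a : 'rV[R]_n -> R) (s : R) (w : T) : \bar R :=
  \int[lebesgue_measure]_(r in `[0%R, s]) (a (X r w))%:E.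

(* Extended-real valued, so that the infimum of the empty set is +oo. *)
Definition first_passage (R : realType) (A : R -> \bar R) (z : R) : \bar R :=
  ereal_inf [set s%:E | s in [set s : R | (0 <= s)%R /\ z%:E <= A s]].

Definition eta (T : Type) (R : realType) (n : nat) (I : Type)
    (X : R -> T -> 'rV[R]_n) (a : I -> 'rV[R]_n -> R) (Z : I -> T -> R)
    (i : I) (w : T) : \bar R :=
  first_passage (fun s => cumulative_intensity X (a i) s w) (Z i w).

Definition tau (T : Type) (R : realType) (n K : nat)
    (X : R -> T -> 'rV[R]_n) (a : 'I_K.+2 -> 'rV[R]_n -> R)
    (Z : 'I_K.+2 -> T -> R) (i : 'I_K.+2) (w : T) : \bar R :=
  Order.min (eta X a Z ord0 w) (eta X a Z i w).

(* Index 0 is the common shock, not an institution. *)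
Definition close_defaults (T : Type) (R : realType) (N : nat)
    (D : 'I_N -> T -> \bar R) (eps : R) (m : nat) : set T :=
  [set w | exists i j : 'I_N, [/\ (1 <= i <= m)%N, (1 <= j <= m)%N, i != j &
     `|D i w - D j w| < eps%:E]].

(* Main.v *)
(* Both events are measurable because the usual conditions make P complete, and
   the first is contained in the second, so it suffices to find an event of
   positive probability on which the newcomer defaults close to institution 1
   while institutions 1..K default at distance more than eps from each other.
   This holds when every eta_i lies in a short window around a prescribed time,
   with the common shock last. On cadlag paths A_i is finite and strictly
   increasing, so eta_i lies in [lo_i, hi_i] as soon as
   A_i(lo_i) < Z_i < A_i(hi_i), and by independence of X and the exponential
   Z_i these inequalities hold jointly with positive probability. *)
Require Import Defs.
From HB Require Import structures.
From mathcomp Require Import all_boot all_order all_algebra.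
From mathcomp Require Import all_classical all_reals all_analysis.
From mathcomp Require Import measurable_realfun.
From mathcomp Require Import lra zify.
Import Order.TTheory GRing.Theory Num.Theory.
Import numFieldNormedType.Exports.
Local Open Scope classical_set_scope.
Local Open Scope ring_scope.
Local Open Scope ereal_scope.

Set Implicit Arguments.
Unset Strict Implicit.
Unset Printing Implicit Defensive.

(** * Right-continuous paths and joint measurability of cumulative intensities *)

(** For [r >= 0] this is the first multiple of [1/(n+1)] strictly to the right of [r]. It takes
    countably many values, and being strictly above [r] lets right limits apply along it. *)
Definition grid (R : realType) (n : nat) (r : R) : R :=
  ((Num.truncn (r * n.+1%:R)).+1%:R / n.+1%:R)%R.

Lemma grid_ge0 (R : realType) (n : nat) (r : R) : (0 <= grid n r)%R.
Proof. by rewrite /grid divr_ge0. Qed.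

Lemma grid_gt (R : realType) (n : nat) (r : R) :
  (0 <= r)%R -> (r < grid n r)%R.
Proof.
by move=> r0; rewrite /grid ltr_pdivlMr// -truncn_le_nat.
Qed.

Lemma grid_cvg (R : realType) (r : R) :
  (0 <= r)%R -> grid n r @[n --> \oo] --> r.
Proof.
move=> r0.
apply: (@squeeze_cvgr _ _ _ _ (fun=> r) (fun n => r + n.+1%:R^-1)%R).
- apply: nearW => n; rewrite (ltW (grid_gt _ r0))/=.
  rewrite /grid ler_pdivrMr// mulrDl mulVf// -natr1 lerD2r.
  by rewrite -truncn_ge_nat// mulr_ge0.
- exact: cvg_cst.
- rewrite -[X in _ --> X]addr0; apply: cvgD; first exact: cvg_cst.
  exact: cvg_harmonic.
Qed.

(* Jointly measurable in (w, r) for every process Y, and equal to Y wherever the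
   path is right-continuous; paths that are not cadlag thus cause no
   measurability problem. *)
Definition right_regularization (T : Type) (R : realType) (Y : R -> T -> R)
    (w : T) (r : R) : \bar R :=
  limn_esup (fun n => (Y (grid n r) w)%:E).

Lemma right_regularization_ge0 (T : Type) (R : realType) (Y : R -> T -> R) w r :
  (forall t w, 0 <= Y t w)%R -> 0 <= right_regularization Y w r.
Proof.
move=> Y0; apply: limf_esup_ge0 => [|n]; last by rewrite lee_fin.
exact: filter_not_empty.
Qed.

Lemma right_regularizationE (T : Type) (R : realType) (Y : R -> T -> R) w r :
  (0 <= r)%R -> Y s w @[s --> r^'+] --> Y r w ->
  right_regularization Y w r = (Y r w)%:E.
Proof.
move=> r0 /cvg_at_rightP Yr.
apply: (@cvg_limn_einf_sup _ (fun n => (Y (grid n r) w)%:E) _ _).2.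
apply/cvg_EFin; first exact: nearW.
apply: (Yr (fun n => grid n r)); split; first by move=> n; exact: grid_gt.
exact: grid_cvg.
Qed.

(** For fixed [n] the time [grid n r] is constant on each cell of the grid, so a preimage is a
    countable union of rectangles; the upper limit over [n] keeps measurability. *)
Lemma measurable_right_regularization (d : measure_display)
    (T : measurableType d) (R : realType) (Y : R -> T -> R) :
  (forall t, (0 <= t)%R -> measurable_fun setT (Y t)) ->
  measurable_fun setT
    (fun p : T * R => right_regularization Y p.1 p.2).
Proof.
move=> mY; apply: (@measurable_fun_limn_esup _ _ _ _
  (fun n (p : T * R) => (Y (grid n p.2) p.1)%:E)) => n.
apply/measurable_EFinP => _ B mB; rewrite setTI.
have -> : (fun p : T * R => Y (grid n p.2) p.1) @^-1` B =
  \bigcup_k ((Y (k.+1%:R / n.+1%:R)%R @^-1` B) `*`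
             [set r : R | Num.truncn (r * n.+1%:R)%R = k]).
  apply/seteqP; split=> [[w r] /= Br|[w r] [k _ [/= Bk rk]]]; last first.
    by rewrite /grid rk.
  by exists (Num.truncn (r * n.+1%:R)).
apply: bigcupT_measurable => k; apply: measurableX.
  by rewrite -[X in measurable X]setTI; apply: mY => //; rewrite divr_ge0.
(* Each cell is a difference of two such half-lines; the cell of index 0 is itself a half-line,
   because [Num.truncn] vanishes on negative numbers. *)
have mle j : measurable [set r : R | (Num.truncn (r * n.+1%:R)%R <= j)%N].
  rewrite (_ : mkset _ = `]-oo, (j.+1%:R / n.+1%:R)%R[%classic)//.
  by apply/seteqP; split=> r /=;
    rewrite in_itv/= truncn_le_nat ltr_pdivlMr.
case: k => [|k].
  rewrite (_ : mkset _ = [set r : R | (Num.truncn (r * n.+1%:R)%R <= 0)%N])//.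
  by apply/seteqP; split=> r /=; rewrite leqn0 => /eqP.
rewrite (_ : mkset _ = [set r : R | (Num.truncn (r * n.+1%:R)%R <= k.+1)%N] `\`
  [set r : R | (Num.truncn (r * n.+1%:R)%R <= k)%N]); last first.
  apply/seteqP; split=> r /=; first by move=> ->; rewrite leqnn ltnn.
  by move=> [rk /negP]; rewrite -ltnNge => kr; apply/eqP; rewrite eqn_leq rk.
exact: measurableD.
Qed.

Definition regular_cumulative (T : Type) (R : realType) (Y : R -> T -> R)
    (s : R) (w : T) : \bar R :=
  \int[lebesgue_measure]_(r in `[0%R, s]) right_regularization Y w r.

(** Tonelli, applied to the jointly measurable regularization cut off to the strip of times in
    [[0, s]]. *)
Lemma measurable_regular_cumulative (d : measure_display)
    (T : measurableType d) (R : realType) (Y : R -> T -> R) (s : R) :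
  (forall t w, 0 <= Y t w)%R ->
  (forall t, (0 <= t)%R -> measurable_fun setT (Y t)) ->
  measurable_fun setT (regular_cumulative Y s).
Proof.
move=> Y0 mY.
pose f (p : T * R) : \bar R :=
  ((fun p : T * R => right_regularization Y p.1 p.2) \_ (setT `*` `[0%R, s])) p.
have -> : regular_cumulative Y s = fubini_F (@lebesgue_measure R) f.
  apply/funext => w; rewrite /regular_cumulative integral_mkcond.
  apply: eq_integral => r _; rewrite /f /fubini_F /= !patchE.
  congr (if _ then _ else _).
  by apply/idP/idP; rewrite !inE/=; [split|case].
apply: measurable_fun_fubini_tonelli_F.
  apply/(measurable_restrictT (fun p : T * R => right_regularization Y p.1 p.2)).
    by apply: measurableX => //; exact: measurable_itv.
  by apply: measurable_funTS; exact: measurable_right_regularization.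
by move=> p; apply: erestrict_ge0 => q _; exact: right_regularization_ge0.
Qed.

(** * Strict growth of integrals along cadlag paths *)

(** A zero integral would make [f] vanish almost everywhere on [D]; as [f] vanishes nowhere there,
    [D] would be null. *)
Lemma integral_gt0 (d : measure_display) (T : measurableType d) (R : realType)
    (mu : {measure set T -> \bar R}) (D : set T) (f : T -> \bar R) :
  measurable D -> measurable_fun D f -> 0 < mu D ->
  (forall x, D x -> 0 < f x) -> 0 < \int[mu]_(x in D) f x.
Proof.
move=> mD mf D0 f0; rewrite lt_neqAle integral_ge0 ?andbT; last first.
  by move=> x /f0 /ltW.
apply/eqP => If0; move: D0; rewrite lt_neqAle => /andP[/eqP + _]; apply.
apply/esym/negligibleP => //.
have : ae_eq mu D f (cst 0).
  apply/ae_eq_integral_abs => //; rewrite [RHS]If0.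
  by apply: eq_integral => x; rewrite inE => /f0 /ltW /gee0_abs.
apply: negligibleS => x Dx /=; apply/not_implyP; split=> //.
by apply/eqP; rewrite gt_eqF ?f0.
Qed.

(** The bound [M] makes the integral up to [lo] finite, so that the positive mass on []lo, hi]]
    increases it strictly. *)
Lemma integral_itv_lt (R : realType) (f : R -> \bar R) (M lo hi : R) :
  measurable_fun setT f -> (0 <= lo)%R -> (lo < hi)%R ->
  (forall r, (0 <= r)%R -> 0 < f r) ->
  (forall r, (0 <= r <= lo)%R -> f r <= M%:E) ->
  \int[lebesgue_measure]_(r in `[0%R, lo]) f r <
  \int[lebesgue_measure]_(r in `[0%R, hi]) f r.
Proof.
move=> mf lo0 lohi f0 fM.
have U : `[0%R, hi]%classic = `[0%R, lo]%classic `|` `]lo, hi]%classic :> set R.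
  by rewrite -itv_bndbnd_setU// bnd_simp// ltW.
rewrite U ge0_integral_setU//; last 3 first.
- exact: measurable_funTS.
- move=> r; rewrite -U/= in_itv/= => /andP[r0 _].
  by rewrite ltW ?f0.
- rewrite disj_set2E; apply/eqP/seteqP; split=> // r []/=.
  by rewrite !in_itv/= => /andP[_ rlo] /andP[+ _]; rewrite ltNge rlo.
have fin : \int[lebesgue_measure]_(r in `[0%R, lo]) f r \is a fin_num.
  rewrite ge0_fin_numE; last first.
    by apply: integral_ge0 => r/=; rewrite in_itv/= => /andP[/f0/ltW].
  apply: (@le_lt_trans _ _ (\int[lebesgue_measure]_(r in `[0%R, lo]) (cst M%:E r))).
    apply: ge0_le_integral => //; last exact: measurable_funTS.
    by move=> r/=; rewrite in_itv/= => /andP[/f0/ltW].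
  rewrite integral_cst//= lebesgue_measure_itv/=; case: ifPn => _.
    by rewrite -EFinB -EFinM ltry.
  by rewrite mule0.
rewrite lteDl//; apply: integral_gt0 => //; first exact: measurable_funTS.
  rewrite [ltRHS]lebesgue_measure_itv/= lte_fin lohi -EFinB lte_fin.
  by rewrite subr_gt0.
move=> r /=; rewrite in_itv/= => /andP[/ltW lor _].
by rewrite f0// (le_trans lo0).
Qed.

(** Right continuity and left limits bound the function near each time, and compactness of [[0, T]]
    makes the bound uniform. *)
Lemma cadlag_comp_bounded (R : realType) (n : nat) (x : R -> 'rV[R]_n)
    (a : 'rV[R]_n -> R) (T : R) :
  cadlag x -> continuous a ->
  exists M : R, forall r, (0 <= r <= T)%R -> (a (x r) <= M)%R.
Proof.
move=> [xr xl] ca.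
have /compact_near_coveringP/near_covering_withinP cov := @segment_compact R 0 T.
suff /cov/filter_ex[M MP] : forall t, `[0%R, T]%classic t ->
    \forall t' \near t & M \near +oo%R,
      `[0%R, T]%classic t' -> (a (x t') <= M)%R.
  by exists M => r r0T; apply: MP; rewrite /= in_itv.
move=> t /=; rewrite in_itv/= => /andP[t0 _].
have nr : \forall s \near t^'+, (a (x s) < a (x t) + 1)%R.
  apply: (@cvgr_lt _ _ _ _ _ (a (x t))); last by rewrite ltrDl.
  exact: cvg_comp (xr t t0) (ca (x t)).
(* The bound to the left of [t] comes from the left limit if [t > 0], and is vacuous at [t = 0]. *)
have [C CP] : exists C : R, \forall s \near t,
    (0 <= s)%R -> (s < t)%R -> (a (x s) <= C)%R.
  move: t0; rewrite le_eqVlt => /predU1P[t0|t0].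
    by exists 0%R; near=> s => s0; rewrite -t0 ltNge s0.
  have /cvg_ex[l xtl] := xl t t0; exists (a l + 1)%R.
  have nl : \forall s \near t^'-, (a (x s) < a l + 1)%R.
    apply: (@cvgr_lt _ _ _ _ _ (a l)); last by rewrite ltrDl.
    exact: cvg_comp xtl (ca l).
  near=> s => _ st; apply/ltW; move: st; near: s; exact: nl.
have [D1 D2] : exists D : R, \forall s \near t,
    (0 <= s)%R -> (a (x s) <= D)%R.
  exists (Num.max (a (x t) + 1) C)%R; near=> s => s0.
  rewrite le_max; have [st|ts|->] := ltgtP s t.
  + by rewrite (near CP s)// orbT.
  + rewrite ltW//; move: ts; near: s; exact: nr.
  + by rewrite lerDl ler01.
exists ([set s | 0 <= s -> a (x s) <= D1]%R, [set M | D1 <= M]%R) => /=.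
  by split=> //; apply: nbhs_pinfty_ge; exact: num_real.
move=> [s M]/= [sD DM]; rewrite in_itv/= => /andP[s0 _].
exact: le_trans (sD s0) DM.
Unshelve. all: by end_near. Qed.

(** * Measurability of passage times and of events modified on a null set *)

(** By monotonicity, passage before [c] means that the level is already reached at some rational
    time below [c], which is a countable union. *)
Lemma measurable_first_passage (d : measure_display) (T : measurableType d)
    (R : realType) (B : R -> T -> \bar R) (z : T -> R) :
  (forall s, (0 <= s)%R -> measurable_fun setT (B s)) ->
  (forall w s t, (0 <= s)%R -> (s <= t)%R -> B s w <= B t w) ->
  measurable_fun setT z ->
  measurable_fun setT (fun w => first_passage (fun s => B s w) (z w)).
Proof.
move=> mB Bmono mz.
apply: (measurability _ (ErealGenInftyO.measurableE R)).
move=> _ [_ [c ->] <-]; rewrite setTI.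
have -> : (fun w => first_passage (fun s => B s w) (z w)) @^-1` `]-oo, c%:E[ =
  \bigcup_(q in [set q : rat | (0 <= ratr q :> R) && (ratr q < c)]%R)
    [set w | (z w)%:E <= B (ratr q) w].
  apply/seteqP; split=> [w /=|w [q /= /andP[q0 qc] zq]].
    rewrite in_itv/= => /ereal_inf_lt[_ [s [s0 zs] <-]]; rewrite lte_fin => sc.
    have [q] := rat_in_itvoo sc; rewrite in_itv/= => /andP[sq qc].
    exists q; first by rewrite /= qc andbT (le_trans s0) ?ltW.
    by apply: le_trans zs _; apply: Bmono => //; exact: ltW.
  rewrite in_itv/=; apply: (@le_lt_trans _ _ (ratr q : R)%:E) => //.
  by apply: ereal_inf_lbound; exists (ratr q).
rewrite bigcup_mkcond; apply: bigcupT_measurable_rat => q.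
case: ifPn => //; rewrite inE/= => /andP[q0 _].
rewrite (_ : mkset _ = ~` (setT `&` [set w | B (ratr q) w < (z w)%:E])).
  apply: measurableC; apply: emeasurable_fun_lt => //; first exact: mB.
  exact/measurable_EFinP.
by rewrite setTI; apply/seteqP; split=> w /=; rewrite leNgt => /negP.
Qed.

Lemma complete_measurable (d : measure_display) (T : measurableType d)
    (R : realType) (P : {measure set T -> \bar R}) (A B N : set T) :
  measure_is_complete P -> P.-negligible N ->
  A `\` N = B `\` N -> measurable B -> measurable A.
Proof.
move=> cP nN AB mB; rewrite -(setUIDK A N) setIC AB.
have mN : measurable N by exact: cP.
apply: measurableU; last exact: measurableD.
by apply: cP; apply: negligibleS nN => x [].
Qed.

(** * Exponential variables in random windows *)

Lemma exponential_prob_itv_gt0 (R : realType) (p q : R) :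
  (0 <= p)%R -> (p < q)%R -> 0 < exponential_prob 1%R `]p, q[.
Proof.
move=> p0 pq; apply: integral_gt0 => //.
- apply: measurable_funTS; apply/measurable_EFinP.
  exact: measurable_exponential_pdf.
- by rewrite [ltRHS]lebesgue_measure_itv/= lte_fin pq -EFinB lte_fin subr_gt0.
- move=> x; rewrite /= in_itv/= => /andP[px _].
  rewrite lte_fin exponential_pdfE ?(le_trans p0 (ltW px))//.
  by rewrite mul1r expR_gt0.
Qed.

Lemma ereal_rat_between (R : realType) (x y : \bar R) :
  0 <= x -> x < y -> exists q : rat, x < (ratr q)%:E < y.
Proof.
case: x => [x| |] // _; case: y => [y| |] //; rewrite ?lte_fin => xy.
  have [q] := rat_in_itvoo xy; rewrite in_itv/= => xqy.
  by exists q; rewrite !lte_fin.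
have [q] : exists q : rat, ratr q \in `]x, (x + 1)%R[.
  by apply: rat_in_itvoo; rewrite ltrDl.
by rewrite in_itv/= => /andP[xq _]; exists q; rewrite lte_fin xq ltry.
Qed.

Lemma independent_exponentials_in_windows (d : measure_display)
    (T : measurableType d) (R : realType) (P : probability T R) (J : finType)
    (G : set (set T)) (Z : J -> {RV P >-> R}) (N : set T)
    (U V : J -> g_sigma_algebraType G -> \bar R) :
  <<s G >> `<=` measurable ->
  mutually_independent P (fun o : option J =>
    if o is Some i then preimage_set_system setT (Z i) measurable
    else <<s G >>) ->
  (forall i (B : set R), measurable B ->
    distribution P (Z i) B = exponential_prob 1%R B) ->
  (forall i, measurable_fun setT (U i)) ->
  (forall i, measurable_fun setT (V i)) ->
  (forall i w, 0 <= U i w) ->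
  P.-negligible N -> (forall i w, ~ N w -> U i w < V i w) ->
  exists C : set T, [/\ measurable C, 0 < P C &
    forall w, C w -> forall i, U i w < (Z i w)%:E < V i w].
Proof.
(* Rational thresholds make the choice of p_i < q_i between U_i and V_i countable,
   so some choice works on a G-event E c of positive probability, on which the
   windows no longer depend on G. *)
move=> Gm indep Zexp mU mV U0 nN UV.
pose p (c : {ffun J -> rat * rat}) i : R := ratr (c i).1.
pose q (c : {ffun J -> rat * rat}) i : R := ratr (c i).2.
pose E c : set T := \bigcap_(i in [set: J]) [set w : g_sigma_algebraType G |
  (U i w < (p c i)%:E) && ((q c i)%:E < V i w)].
have GE c : <<s G >> (E c).
  apply: (@fin_bigcap_measurable _ (g_sigma_algebraType G)) => [|i _].
    exact: finite_finset.
  rewrite (_ : mkset _ = (setT `&` [set w | U i w < (p c i)%:E]) `&`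
                         (setT `&` [set w | (q c i)%:E < V i w])).
    by apply: measurableI; [apply: emeasurable_fun_infty_o|
                            apply: emeasurable_fun_o_infty].
  by rewrite !setTI; apply/seteqP; split=> w /= => [/andP[]|[-> ->]].
pose good c := [forall i, p c i < q c i]%R.
have [c [gc Ec0]] : exists c, good c /\ 0 < P (E c).
  apply: contrapT => /forallNP noc.
  have nE c : good c -> P.-negligible (E c).
    move=> gc; apply/negligibleP; first exact: Gm.
    apply/eqP; rewrite -measure_le0 leNgt; apply/negP => Ec0.
    by apply: (noc c).
  (* If all good [E c] were null, they and [N] would cover the space: off [N], two rationals fit
     between [U i w] and [V i w] for every [i]. The sets [E c] are enumerated through [unpickle]. *)
  have : P.-negligible (N `|` \bigcup_k (if unpickle k is Some c then
      if good c then E c else set0 else set0)).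
    apply: negligibleU => //; apply: negligible_bigcup => k.
    case: unpickle => [c|]; last exact: negligible_set0.
    by case: ifPn => [/nE//|_]; exact: negligible_set0.
  rewrite (_ : _ `|` _ = setT); last first.
    apply/seteqP; split=> // w _; have [|/UV Nw] := pselect (N w); [by left|right].
    have /choice[c cP] i : exists c : rat * rat,
        [&& U i w < (ratr c.1)%:E, (ratr c.1 < ratr c.2 :> R)%R &
            (ratr c.2)%:E < V i w].
      have [a /andP[Ua aV]] := ereal_rat_between (U0 i w) (Nw i).
      have [b /andP[ab bV]] := ereal_rat_between (le_trans (U0 i w) (ltW Ua)) aV.
      by exists (a, b); rewrite /= Ua bV -lte_fin ab.
    exists (pickle [ffun i => c i]) => //; rewrite pickleK.
    rewrite (_ : good _); last first.
      by apply/forallP => i; rewrite /p /q !ffunE; have /and3P[] := cP i.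
    by move=> i _ /=; rewrite /p /q !ffunE; have /and3P[-> _ ->] := cP i.
  move/(negligibleP P measurableT) => /eqP; rewrite [X in X == _]probability_setT.
  by rewrite onee_eq0.
pose F (o : option J) : set T :=
  if o is Some i then Z i @^-1` `]p c i, q c i[ else E c.
have mF o : measurable (F o).
  case: o => [i|]; last exact: Gm (GE c).
  by rewrite -[X in measurable X]setTI; apply: measurable_funP.
have gci i : (p c i < q c i)%R by move/forallP : gc; exact.
have F0 o : 0 < P (F o).
  case: o => [i|//].
  have -> : P (F (Some i)) = distribution P (Z i) `]p c i, q c i[ by [].
  rewrite Zexp; last exact: measurable_itv.
  apply: exponential_prob_itv_gt0 => //.
  (* A point of [E c] gives [0 <= U i w < p c i], so the window lies where the exponential density
     is positive. *)
  have /set0P[w Ew] : E c != set0.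
    by apply/eqP => Ec; move: Ec0; rewrite Ec measure0 ltxx.
  have /= /andP[Uc _] := Ew i I.
  by rewrite -lee_fin ltW// (le_lt_trans (U0 i w)).
exists (\bigcap_(o in [set o | o \in [set: option J]%SET]) F o); split.
- by apply: fin_bigcap_measurable => //; exact: finite_finset.
- rewrite indep; last by case=> [i _|_] //=; exists `]p c i, q c i[%classic;
    [exact: measurable_itv|rewrite setTI].
  by elim/big_ind : _ => // x y; exact: mule_gt0.
- move=> w Cw i.
  have /andP[Up qV] := Cw None (finset.in_setT _) i I.
  have /= := Cw (Some i) (finset.in_setT _); rewrite in_itv/= => /andP[pZ Zq].
  by rewrite (lt_trans Up)// (lt_trans _ qV).
Qed.

(** * Cumulative intensities as functionals of the process *)

(* <<s process_cylinders X >> is convertible to process_sigma X; naming the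
   generators lets g_sigma_algebraType turn it into a measurableType. *)
Definition process_cylinders (T : Type) (R : realType) (n : nat)
    (X : R -> T -> 'rV[R]_n) : set (set T) :=
  \bigcup_(t in [set t : R | (0 <= t)%R])
    preimage_set_system setT (X t) (@borel_rV R n).

Lemma process_sigma_measurable (d : measure_display) (T : measurableType d)
    (R : realType) (n : nat) (X : R -> T -> 'rV[R]_n) :
  vector_process X -> <<s process_cylinders X >> `<=` measurable.
Proof.
move=> mX; apply: smallest_sub; first exact: sigma_algebra_measurable.
by move=> A [t t0 XA]; exact: mX XA.
Qed.

(** Measurability is relative to the sigma-algebra generated by [X], so that independence from the
    [Z i] applies to events about the intensities. *)
Lemma measurable_comp_process (d : measure_display) (T : measurableType d)
    (R : realType) (n : nat) (X : R -> T -> 'rV[R]_n) (a : 'rV[R]_n -> R)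
    (t : R) :
  continuous a -> (0 <= t)%R ->
  measurable_fun setT
    (fun w : g_sigma_algebraType (process_cylinders X) => a (X t w)).
Proof.
move=> ca t0; apply: (measurability _ (RGenOInfty.measurableE R)).
move=> _ [_ [c ->] <-]; apply: sub_sigma_algebra; exists t => //.
exists (a @^-1` `]c, +oo[) => //; apply: sub_sigma_algebra.
by move/continuousP : ca; apply; exact: interval_open.
Qed.

Lemma right_regularization_comp (T : Type) (R : realType) (n : nat)
    (X : R -> T -> 'rV[R]_n) (a : 'rV[R]_n -> R) (w : T) (r : R) :
  cadlag (fun t => X t w) -> continuous a -> (0 <= r)%R ->
  right_regularization (fun t w => a (X t w)) w r = (a (X r w))%:E.
Proof.
move=> [Xr _] ca r0.
apply: (right_regularizationE (Y := fun t w => a (X t w))) => //.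
exact: cvg_comp (Xr r r0) (ca (X r w)).
Qed.

Lemma cumulative_intensityE (T : Type) (R : realType) (n : nat)
    (X : R -> T -> 'rV[R]_n) (a : 'rV[R]_n -> R) (s : R) (w : T) :
  cadlag (fun t => X t w) -> continuous a ->
  cumulative_intensity X a s w =
  regular_cumulative (fun t w => a (X t w)) s w.
Proof.
move=> cX ca; apply: eq_integral => r; rewrite inE/= in_itv/= => /andP[r0 _].
by rewrite right_regularization_comp.
Qed.

Lemma measurable_right_regularization_path (d : measure_display)
    (T : measurableType d) (R : realType) (Y : R -> T -> R) (w : T) :
  (forall t, (0 <= t)%R -> measurable_fun setT (Y t)) ->
  measurable_fun setT (right_regularization Y w).
Proof.
by move/measurable_right_regularization => /(measurable_fun_pair2 w).
Qed.

Lemma regular_cumulative_ge0 (T : Type) (R : realType) (Y : R -> T -> R)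
    (s : R) (w : T) :
  (forall t w, 0 <= Y t w)%R -> 0 <= regular_cumulative Y s w.
Proof.
by move=> Y0; apply: integral_ge0 => r _; exact: right_regularization_ge0.
Qed.

Lemma regular_cumulative_le (d : measure_display) (T : measurableType d)
    (R : realType) (Y : R -> T -> R) (w : T) (s t : R) :
  (forall t w, 0 <= Y t w)%R ->
  (forall t, (0 <= t)%R -> measurable_fun setT (Y t)) ->
  (s <= t)%R -> regular_cumulative Y s w <= regular_cumulative Y t w.
Proof.
move=> Y0 mY st; apply: ge0_subset_integral => //.
- by apply: measurable_funTS; exact: measurable_right_regularization_path.
- by move=> r _; exact: right_regularization_ge0.
- by move=> r/=; rewrite !in_itv/= => /andP[-> /le_trans->].
Qed.

Lemma regular_cumulative_lt (d : measure_display) (T : measurableType d)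
    (R : realType) (n : nat) (X : R -> T -> 'rV[R]_n) (a : 'rV[R]_n -> R)
    (w : T) (lo hi : R) :
  cadlag (fun t => X t w) -> continuous a -> (forall x, 0 < a x)%R ->
  (0 <= lo)%R -> (lo < hi)%R ->
  regular_cumulative (fun t w => a (X t w)) lo w <
  regular_cumulative (fun t w => a (X t w)) hi w.
Proof.
move=> cX ca a0 lo0 lohi; have [M aM] := cadlag_comp_bounded lo cX ca.
apply: (integral_itv_lt (M := M)) => //.
(* Path measurability follows from joint measurability for any sigma-algebra making every [a (X t)]
   measurable; the one generated by [X] always does. *)
- apply: (measurable_right_regularization_path
    (T := g_sigma_algebraType (process_cylinders X))).
  by move=> t t0; exact: measurable_comp_process.
- by move=> r r0; rewrite right_regularization_comp// lte_fin.
- move=> r r0; rewrite right_regularization_comp ?lee_fin ?aM//.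
  by case/andP: r0.
Qed.

Lemma first_passage_window (R : realType) (A : R -> \bar R) (z lo hi : R) :
  (forall s t, (s <= t)%R -> A s <= A t) -> (0 <= hi)%R ->
  A lo < z%:E < A hi -> lo%:E <= first_passage A z <= hi%:E.
Proof.
move=> Amono hi0 /andP[loz zhi]; apply/andP; split.
  apply/ereal_infP => _ [s [s0 zs] <-]; rewrite lee_fin leNgt.
  apply/negP => slo; have := lt_le_trans loz zs.
  by rewrite ltNge Amono// ltW.
by apply: ereal_inf_lbound; exists hi => //; split=> //; exact: ltW.
Qed.

(** * Close defaults and the slot configuration *)

Lemma measurable_close_defaults (d : measure_display) (T : measurableType d)
    (R : realType) (N : nat) (D : 'I_N -> T -> \bar R) (eps : R) (m : nat) :
  (forall i, measurable_fun setT (D i)) ->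
  measurable (close_defaults D eps m).
Proof.
move=> mD.
rewrite (_ : close_defaults D eps m = \bigcup_(p in [set p : 'I_N * 'I_N |
    [&& (1 <= p.1 <= m)%N, (1 <= p.2 <= m)%N & p.1 != p.2]])
    [set w | `|D p.1 w - D p.2 w| < eps%:E]).
  apply: fin_bigcup_measurable => [|p _]; first exact: finite_finset.
  rewrite -[X in measurable X]setTI; apply: emeasurable_fun_infty_o => //.
  by apply: measurableT_comp => //; exact: emeasurable_funB.
apply/seteqP; split=> w.
  by move=> [i [j [im jm ij Dij]]]; exists (i, j) => //=; rewrite im jm ij.
by move=> [[i j] /= /and3P[im jm ij] Dij]; exists i, j.
Qed.

Lemma close_defaultsS (T : Type) (R : realType) (N : nat)
    (D : 'I_N -> T -> \bar R) (eps : R) (m m' : nat) :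
  (m <= m')%N -> close_defaults D eps m `<=` close_defaults D eps m'.
Proof.
move=> mm' w [i [j [/andP[i1 im] /andP[j1 jm] ij Dij]]].
by exists i, j; rewrite i1 j1 (leq_trans im) ?(leq_trans jm).
Qed.

(* The common shock, index 0, comes after everybody else, and the newcomer K.+1
   shares the slot of institution 1. *)
Definition slot (K : nat) (i : 'I_K.+2) : nat :=
  if i == 0%N :> nat then K.+1 else if i == K.+1 :> nat then 1%N else i.

(** Centres are spaced by [2 * eps] and windows have half-width [eps / 4]: times in one slot differ
    by at most [eps / 2], times in distinct slots by at least [3 * eps / 2]. *)
Definition in_slot (R : realType) (K : nat) (eps : R) (i : 'I_K.+2)
    (x : \bar R) :=
  (2 * eps * (slot i)%:R - eps / 4)%:E <= x <=
  (2 * eps * (slot i)%:R + eps / 4)%:E.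

Lemma default_slots_close (T : Type) (R : realType) (K : nat)
    (e : 'I_K.+2 -> T -> \bar R) (eps : R) (w : T) :
  let D := fun i w => Order.min (e ord0 w) (e i w) in
  (1 <= K)%N -> (0 < eps)%R ->
  (forall i : 'I_K.+2, in_slot eps i (e i w)) ->
  close_defaults D eps K.+1 w /\ ~ close_defaults D eps K w.
Proof.
move=> D K1 eps0 ew.
have [x xE] : exists x : 'I_K.+2 -> R, forall i, e i w = (x i)%:E.
  exists (fun i => fine (e i w)) => i; rewrite fineK// fin_numE.
  have /andP[lo hi] := ew i.
  by apply/andP; split; apply/eqP => ei; rewrite ei in lo hi.
have xw i : (2 * eps * (slot i)%:R - eps / 4 <= x i <=
             2 * eps * (slot i)%:R + eps / 4)%R.
  by have := ew i; rewrite /in_slot xE !lee_fin.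
(* Every institution, the newcomer included since [1 <= K], has slot at most [K], while the shock
   has slot [K.+1]; the minimum is therefore the institution's own time. *)
have De (i : 'I_K.+2) : (1 <= i)%N -> D i w = (x i)%:E.
  move=> i1; rewrite /D !xE; apply/min_idPr; rewrite lee_fin.
  have /andP[+ _] := xw ord0; have /andP[_ +] := xw i.
  have : (2 * eps * (slot i)%:R <= 2 * eps * K%:R)%R.
    apply: ler_wpM2l; first by lra.
    rewrite ler_nat /slot; have := ltn_ord i.
    by case: eqP => ?; [lia|case: eqP => ?; lia].
  have -> : slot (ord0 : 'I_K.+2) = K.+1 by [].
  have -> : K.+1%:R = (K%:R + 1 :> R)%R by rewrite natr1.
  rewrite mulrDr mulr1; lra.
have K0 : (1 < K.+2)%N by [].
pose i1 := Ordinal K0; pose iK := @ord_max K.+1.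
split.
  exists i1, iK; split => //=; rewrite ?ltnS ?leqnn//.
    by rewrite -val_eqE/= neq_ltn ltnS K1.
  rewrite !De// -EFinB abse_EFin lte_fin ltr_norml.
  have := xw i1; have := xw iK; rewrite /slot/= eqxx.
  rewrite (_ : (1 == K.+1)%N = false) /=; last by lia.
  by move=> /andP[? ?] /andP[? ?]; apply/andP; split; lra.
move=> [i [j [/andP[i1' iK'] /andP[j1 jK] ij]]].
rewrite !De// -EFinB abse_EFin lte_fin; apply/negP; rewrite -leNgt.
wlog : i j i1' iK' j1 jK ij / (i < j)%N.
  move=> H; move: (ij); rewrite -val_eqE/= neq_ltn => /orP[ltij|ltji].
    exact: H.
  by rewrite distrC; apply: H => //; rewrite eq_sym.
move=> ltij; have := xw i; have := xw j.
have sl (k : 'I_K.+2) : (1 <= k <= K)%N -> slot k = k :> nat.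
  by rewrite /slot => ?; case: eqP => ?; [lia|case: eqP => ?; lia].
rewrite !sl ?i1' ?j1// => /andP[? ?] /andP[? ?].
have : (2 * eps * (i%:R + 1) <= 2 * eps * j%:R)%R.
  by apply: ler_wpM2l; [lra|rewrite natr1 ler_nat].
rewrite mulrDr mulr1 => ?.
by rewrite ler_normr; apply/orP; right; lra.
Qed.

(** * Assembly of the strict inequality *)

Lemma eta_regular_cumulative (T : Type) (R : realType) (n K : nat)
    (X : R -> T -> 'rV[R]_n) (a : 'I_K.+2 -> 'rV[R]_n -> R)
    (Z : 'I_K.+2 -> T -> R) (i : 'I_K.+2) (w : T) :
  cadlag (fun t => X t w) -> (forall i, continuous (a i)) ->
  Defs.eta X a Z i w = first_passage
    (fun s => regular_cumulative (fun t w => a i (X t w)) s w) (Z i w).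
Proof.
move=> cX ca; rewrite /Defs.eta; congr first_passage.
by apply/funext => s; rewrite cumulative_intensityE.
Qed.

Unset Implicit Arguments.

Theorem theorem17 (R : realType) (disp : measure_display)
    (Omega : measurableType disp) (P : probability Omega R)
    (F : R -> set (set Omega)) (d K : nat)
    (X : R -> Omega -> 'rV[R]_d)
    (Z : 'I_K.+2 -> {RV P >-> R})
    (alpha : 'I_K.+2 -> 'rV[R]_d -> R)
    (eps : R)
    (hK : (1 <= K)%N)
    (hF : usual_conditions P F)
    (hX : vector_process X)
    (hXpaths : {ae P, forall w, cadlag (fun t => X t w)})
    (hZexp : forall i (B : set R), measurable B ->
       distribution P (Z i) B = exponential_prob 1%R B)
    (hindep : mutually_independent P
       (generated_sigmas X (fun i => Z i : Omega -> R)))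
    (halpha_pos : forall i x, (0 < alpha i x)%R)
    (halpha_cont : forall i, continuous (alpha i))
    (hA : forall i, {ae P, forall w,
       cumulative_intensity X (alpha i) s w @[s --> +oo%R] --> +oo})
    (heps : (0 < eps)%R) :
  P (close_defaults (tau X alpha (fun i => Z i : Omega -> R)) eps K) <
  P (close_defaults (tau X alpha (fun i => Z i : Omega -> R)) eps K.+1).
Proof.
pose Zf i : Omega -> R := Z i.
pose Y i t w := alpha i (X t w).
pose B i s w := regular_cumulative (Y i) s w.
pose N := ~` [set w | cadlag (fun t => X t w)].
have nN : P.-negligible N by [].
have goodN w : ~ N w -> cadlag (fun t => X t w) by move/contrapT.
(* Null sets belong to [F 0], whose members are measurable. *)
have cP : measure_is_complete P.
  case: hF => F1 _ _ F4 A /F4 F0A.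
  by have [_ F0m] := F1 0%R (lexx _); exact: F0m.
have Xm : <<s process_cylinders X >> `<=` measurable.
  exact: process_sigma_measurable.
have Y0 i t w : (0 <= Y i t w)%R by exact/ltW/halpha_pos.
have mY i t : (0 <= t)%R -> measurable_fun setT
    (Y i t : g_sigma_algebraType (process_cylinders X) -> R).
  by move=> t0; exact: measurable_comp_process.
have mB i s : measurable_fun setT
    (B i s : g_sigma_algebraType (process_cylinders X) -> \bar R).
  apply: (measurable_regular_cumulative
    (T := g_sigma_algebraType (process_cylinders X))) => //.
  exact: mY.
have mBO i s : measurable_fun setT (B i s).
  by move=> _ A mA; apply: Xm; exact: mB.
have Bmono i w s t : (s <= t)%R -> B i s w <= B i t w.
  by apply: (regular_cumulative_le
    (T := g_sigma_algebraType (process_cylinders X))) => //; exact: mY.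
pose eta' i w := first_passage (fun s => B i s w) (Z i w).
have meta i : measurable_fun setT (eta' i).
  apply: measurable_first_passage => // w s t _; exact: Bmono.
pose tau' i w := Order.min (eta' ord0 w) (eta' i w).
have etaE i w : ~ N w -> Defs.eta X alpha Zf i w = eta' i w.
  by move=> /goodN cX; rewrite eta_regular_cumulative.
(* [tau'] is measurable everywhere and agrees with [tau] off [N], so completeness transfers
   measurability to the event built from [tau]. *)
have mclose m : measurable (close_defaults (tau X alpha Zf) eps m).
  apply: (complete_measurable cP nN (B := close_defaults tau' eps m)).
    apply/seteqP; split=> w [[i [j [im jm ij Dij]]] Nw]; split=> //;
      exists i, j; split=> //; move: Dij; by rewrite /tau /tau' !etaE.
  apply: measurable_close_defaults => i; exact: measurable_mine.
pose c (i : 'I_K.+2) : R := (2 * eps * (slot i)%:R)%R.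
(* All slots are at least 1, so every window starts at a positive time. *)
have c_ge i : (2 * eps <= c i)%R.
  rewrite /c -[leLHS]mulr1; apply: ler_wpM2l; first by lra.
  by rewrite ler1n /slot; case: eqP => ?; [|case: eqP]; lia.
have Bwindow i w : ~ N w -> B i (c i - eps / 4)%R w < B i (c i + eps / 4)%R w.
  by move=> Nw; apply: regular_cumulative_lt (goodN _ Nw) _ _ _ _ => //;
    have := c_ge i; lra.
have [C [mC C0 CP]] := independent_exponentials_in_windows Xm hindep hZexp
  (fun i => mB i (c i - eps / 4)%R) (fun i => mB i (c i + eps / 4)%R)
  (fun i w => regular_cumulative_ge0 _ w (Y0 i)) nN Bwindow.
have mN : measurable N by exact: cP.
have CN : C `\` N `<=` close_defaults (tau X alpha Zf) eps K.+1 `\`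
                       close_defaults (tau X alpha Zf) eps K.
  move=> w [Cw Nw]; apply: (default_slots_close (e := Defs.eta X alpha Zf)) => // i.
  rewrite etaE//; apply: first_passage_window (CP w Cw i).
    by move=> s t; exact: Bmono.
  by have := c_ge i; rewrite /c; lra.
(* The larger event is split into the smaller one and the difference. The smaller has finite
   probability, so it remains to see that the difference has positive probability; it contains [C]
   minus the null set [N]. *)
rewrite -(setDUK (close_defaultsS (D := tau X alpha Zf) (leqnSn K))).
rewrite measureU//; last 2 first.
- exact: measurableD.
- by rewrite setDIK.
rewrite lteDl; last by rewrite fin_num_measure.
apply: (lt_le_trans _ (le_measure P _ _ CN)); rewrite ?inE; last 2 first.
- exact: measurableD.
- exact: measurableD.
rewrite measureD//; last by rewrite ltey_eq fin_num_measure.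
suff CN0 : P (C `&` N) = 0 by rewrite [X in _ - X]CN0 sube0.
apply/negligibleP; first exact: measurableI.
by apply: negligibleS nN => w [].
Qed.
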